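(* Let $S=X\times Y$ be a compact Polish space (with $X,Y$ Polish), $\mu^*\in P(S)$, $\varepsilon\ge0$, $G\in\mathcal{G}$. Assume that $c:S\times S\to\mathbb{R}_+$ is non-negative, continuous, and such that $c(s,r)=0$ if and only if $s=r$, and that $\ell(\cdot,G)$ is continuous. Let $K_s=P(S)$ for every $s\in S$, and suppose that $K_s$ is non-empty, weakly* closed and convex for $\mu^*$-a.e. $s$ and that $\Omega_{K,c,\varepsilon}$ is non-empty. Then $$I_{\Omega_{K,c,\varepsilon}}(G)=\inf_{\lambda\ge0}\left(\lambda\varepsilon+\int_S\phi_{\lambda,G}(x,y)\,d\mu^*(x,y)\right),$$ where $$\phi_{\lambda,G}(x,y):=\sup_{(u,v)\in S}\Big(\ell(u,v,G)-\lambda c\big((x,y),(u,v)\big)\Big).$$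
   Context: $P(S)$ is the set of Borel probability measures on $S$; weak* closedness in $P(S)$ refers to the duality with $C(S)$. $\mathcal{G}$ is a parameter space and $\ell:S\times\mathcal{G}\to[0,\infty)$ is a measurable loss function, written $\ell(u,v,G)$ for $\ell((u,v),G)$. The notation $\pi_{S|S}:S\to K_s$ means a $\mu^*$-measurable kernel $s\mapsto\pi_{S|S=s}\in P(S)$ such that $\pi_{S|S=s}\in K_s$ for $\mu^*$-a.e. $s\in S$. Define $$\Omega_{K,c,\varepsilon}:=\Big\{\pi_{S|S}:S\to K_s\ :\ \int_S\int_S c(s,r)\,d\pi_{S|S=s}(r)\,d\mu^*(s)\le\varepsilon\Big\},$$ $$I_{\Omega_{K,c,\varepsilon}}(G):=\sup_{\pi_{S|S}\in\Omega_{K,c,\varepsilon}}\int_S\int_S\ell(r,G)\,d\pi_{S|S=s}(r)\,d\mu^*(s).$$ *)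

(* Defs.v *)
From HB Require Import structures.
From mathcomp Require Import all_boot all_order all_algebra.
From mathcomp Require Import all_classical all_reals all_analysis.

Set Implicit Arguments.
Unset Strict Implicit.
Unset Printing Implicit Defensive.

Import Order.TTheory GRing.Theory Num.Theory.
Import numFieldNormedType.Exports.

Local Open Scope classical_set_scope.
Local Open Scope ring_scope.

(* The product carries both structures in the library, but not their join. *)
HB.instance Definition _ (X Y : ptopologicalType) :=
  Topological.on (X * Y)%type.

Definition polish (R : realType) (T : topologicalType) : Prop :=
  (exists2 D : set T, countable D & dense D) /\
  exists (M : metricType R) (f : T -> M) (g : M -> T),
    [/\ continuous f, continuous g, cancel f g, cancel g f &
      forall F : set_system M, ProperFilter F -> cauchy F ->
        exists x : M, F --> x].

(* A measurableType is pointed in the library, hence ptopologicalType; no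
   generality is lost for spaces that carry a probability measure. *)
Definition borel (T : ptopologicalType) := g_sigma_algebraType (@open T).

(* P(T).  A MathComp-Analysis measure is a function on all sets, so two elements
   may agree on every Borel set without being equal.  Sets that are closed or
   convex in the sense defined below never separate two such elements. *)
Definition borel_prob (R : realType) (T : ptopologicalType) :=
  pprobability (borel T) R.

(* The pairing of a probability measure with C(T). *)
Definition dual_pairing (R : realType) (T : ptopologicalType)
    (nu : borel_prob R T) : prod_topology (fun _ : continuousType T R => R) :=
  fun f => (\int[nu]_(x in [set: borel T]) f x)%R.

Definition weak_star (R : realType) (T : ptopologicalType) :=
  initial_topology (@dual_pairing R T).

Definition weak_star_closed (R : realType) (T : ptopologicalType)
    (A : set (borel_prob R T)) : Prop :=
  @closed (weak_star R T) A.

Definition prob_convex (R : realType) (T : ptopologicalType)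
    (A : set (borel_prob R T)) : Prop :=
  forall (nu1 nu2 nu : borel_prob R T) (t : R),
    A nu1 -> A nu2 -> 0 <= t <= 1 ->
    (forall U : set (borel T), measurable U ->
      nu U = (t%:E * nu1 U + (1 - t)%:E * nu2 U)%E) ->
    A nu.

(* The same set T with the sigma-algebra of mu-measurable sets, i.e. the
   completion of the Borel sigma-algebra with respect to mu (its Caratheodory
   presentation, which is the one in the library), and the completed measure. *)
Definition completed (R : realType) (T : ptopologicalType)
    (mu : borel_prob R T) :=
  caratheodory_type (mu_ext mu).

Definition completion (R : realType) (T : ptopologicalType)
    (mu : borel_prob R T) : {measure set (completed mu) -> \bar R} :=
  @completed_measure_extension _ (borel T) R mu.

(* pi is mu-measurable: borel_prob carries the sigma-algebra generated by the
   evaluations nu |-> nu U at Borel sets U.  The outer integral is taken against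
   the completed measure because its integrand need not be Borel. *)
Definition Omega (R : realType) (T : ptopologicalType) (mu : borel_prob R T)
    (K : T -> set (borel_prob R T)) (c : T * T -> R) (eps : R) :
    set (completed mu -> borel_prob R T) :=
  [set pi | [/\ measurable_fun [set: completed mu] pi,
      {ae mu, forall s, K s (pi s)} &
      (\int[completion mu]_s \int[pi s]_r (c (s, r))%:E <= eps%:E)%E]].
Arguments Omega {R T} mu K c eps _.

Definition robust_value (R : realType) (T : ptopologicalType) (Par : Type)
    (mu : borel_prob R T) (ell : T * Par -> R) (G : Par)
    (Om : set (completed mu -> borel_prob R T)) : \bar R :=
  ereal_sup [set (\int[completion mu]_s \int[pi s]_r (ell (r, G))%:E)%E
            | pi in Om].

Definition phi (R : realType) (T : ptopologicalType) (Par : Type)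
    (c : T * T -> R) (ell : T * Par -> R) (lam : R) (G : Par) (s : T) : \bar R :=
  ereal_sup [set (ell (r, G) - lam * c (s, r))%:E | r in [set: T]].

(* Main.v *)
(* Every plan satisfies ell(r) <= phi_lam(s) + lam c(s, r); integrating gives
   one inequality.  For the other one, a measurable map tau with tau(s) an almost
   maximizer of ell(r) - lam c(s, r) exists because, by compactness, finitely
   many values r suffice.  When eps > 0, consider the points
   (cost of tau, gain of tau) of the plane, over all measurable maps tau.
   Mixing two maps pointwise is a plan realizing any convex combination of their
   points, so the slopes seen from (eps, optimal value) are separated, and a
   separating slope is a multiplier lam; testing it against almost maximizers
   finishes.  The case eps = 0 has no Slater point, but there
   phi_lam <= ell + e for large lam, again by compactness, and the identity map
   is a plan of zero cost. *)
Require Import Defs.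
From HB Require Import structures.
From mathcomp Require Import all_boot all_order all_algebra.
From mathcomp Require Import all_classical all_reals all_analysis.
From mathcomp Require Import finmap measurable_realfun ring lra.

Set Implicit Arguments.
Unset Strict Implicit.
Unset Printing Implicit Defensive.

Import Order.TTheory GRing.Theory Num.Theory.
Import numFieldNormedType.Exports.

Local Open Scope classical_set_scope.
Local Open Scope ring_scope.

(** * Continuity, compactness and measurability in two variables *)

Lemma continuous_section_l (S T U : topologicalType) (f : S * T -> U) (t : T) :
  continuous f -> continuous (fun s => f (s, t)).
Proof.
move=> cf s; apply: continuous_comp; last exact: cf.
by apply: cvg_pair; [exact: cvg_id|exact: cvg_cst].
Qed.

Lemma continuous_section_r (S T U : topologicalType) (f : S * T -> U) (s : S) :
  continuous f -> continuous (fun t => f (s, t)).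
Proof.
move=> cf t; apply: continuous_comp; last exact: cf.
by apply: cvg_pair; [exact: cvg_cst|exact: cvg_id].
Qed.

(** Compactness is used twice: in the first variable it makes continuity at [r] uniform in [s], so
    that [W r] is a neighbourhood of [r]; in the second it extracts a finite subcover. A supremum
    over all [r] thus reduces, up to [e], to finitely many sections. *)
Lemma compact_uniform_net (R : realType) (T : ptopologicalType)
    (f : T * T -> R) (e : R) :
  compact [set: T] -> continuous f -> 0 < e ->
  exists (l : seq T) (U : T -> set T),
    [/\ forall r, open (U r),
        forall x, exists2 r, r \in l & U r x &
        forall s r x, U r x -> `|f (s, x) - f (s, r)| < e].
Proof.
move=> cT cf e0.
pose W r : set T := [set x | forall s, `|f (s, x) - f (s, r)| < e].
have W_nbhs r : nbhs r (W r).
  have /compact_near_coveringP near_cov := cT.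
  suff near_s s : [set: T] s -> \forall s' \near s & x \near nbhs r,
      `|f (s', x) - f (s', r)| < e.
    by apply: filterS (near_cov _ _ _ _ near_s) => x Wx s; exact: Wx.
  move=> _.
  have e20 : 0 < e / 2 by rewrite divr_gt0.
  have /cvgrPdist_lt /(_ _ e20) [[A B] [/= nA nB] AB] := cf (s, r).
  exists (A, B) => // -[s' x] [/= As' Bx].
  have /= H1 := AB (s', x) (conj As' Bx).
  have /= H2 := AB (s', r) (conj As' (nbhs_singleton nB)).
  rewrite (_ : _ - _ = (f (s, r) - f (s', r)) - (f (s, r) - f (s', x)));
    last by lra.
  by rewrite (le_lt_trans (ler_normB _ _))// [ltRHS]splitr ltrD.
pose U r : set T := interior (W r).
have := cT; rewrite compact_cover => /(_ T [set: T] U)[].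
- by move=> r _; exact: open_interior.
- by move=> x _; exists x => //; exact: W_nbhs.
move=> D' _ cD; exists (enum_fset D'), U; split.
- by move=> r; exact: open_interior.
- by move=> x; have [r /= rD Ux] := cD x I; exists r.
- by move=> s r x /interior_subset; exact.
Qed.

Lemma continuous_borel_measurable (R : realType) (T : ptopologicalType)
    (f : T -> R) : continuous f -> measurable_fun [set: borel T] f.
Proof.
move=> /continuousP cf.
apply: (measurability _ (RGenOpens.measurableE R)).
move=> _ [_ [a [b ->] <-]]; rewrite setTI.
by apply: sub_sigma_algebra; exact/cf/interval_open.
Qed.

Lemma measurable_completed_id (R : realType) (T : ptopologicalType)
    (mu : borel_prob R T) :
  measurable_fun [set: completed mu] (id : completed mu -> borel T).
Proof.
by move=> _ A mA; rewrite setTI; exact: caratheodory_measurable_mu_ext.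
Qed.

Lemma continuous_completed_measurable (R : realType) (T : ptopologicalType)
    (mu : borel_prob R T) (f : T -> R) :
  continuous f -> measurable_fun [set: completed mu] (f : completed mu -> R).
Proof.
move=> /continuous_borel_measurable mf.
exact: (measurableT_comp mf (@measurable_completed_id _ _ mu)).
Qed.

(** An open set of [T * T] need not lie in the product sigma-algebra without a countable base, so
    [f] is written as a limit of functions that replace the second variable by a point of a finite
    net. Each of these is measurable as a finite case split between sections of [f]. *)
Lemma continuous_joint_measurable (R : realType) (T : ptopologicalType)
    (mu : borel_prob R T) (f : T * T -> R) :
  compact [set: T] -> continuous f ->
  measurable_fun [set: completed mu * borel T] f.
Proof.
move=> cT cf.
have cf1 r := continuous_section_l (t := r) cf.
have /choice [lU HlU] : forall n : nat, exists lU : seq T * (T -> set T),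
    [/\ forall r, open (lU.2 r),
        forall x, exists2 r, r \in lU.1 & lU.2 r x &
        forall s r x, lU.2 r x -> `|f (s, x) - f (s, r)| < n.+1%:R^-1].
  move=> n; have [//|l [U H]] := @compact_uniform_net R T f n.+1%:R^-1 cT cf.
  by exists (l, U).
(* The first [r] of the list with [z.2] in [U r] is chosen; the default 0 is never reached when the
   sets [U r] cover. *)
pose g (l : seq T) (U : T -> set T) (z : completed mu * borel T) : R :=
  foldr (fun r acc => if z.2 \in U r then f (z.1 : T, r) else acc) 0 l.
have mg l U : (forall r, open (U r)) -> measurable_fun setT (g l U).
  move=> oU; elim: l => [|r l IH] /=; first exact: measurable_cst.
  apply: measurable_fun_ifT => //.
    have mU : measurable (U r : set (borel T)) by exact: sub_sigma_algebra.
    have mU2 : measurable_fun setT (fun x : borel T => x \in (U r : set T)).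
      apply: (measurable_fun_bool true); rewrite setTI (_ : _ @^-1` _ = U r)//.
      by apply/seteqP; split=> x; [exact: set_mem|exact: mem_set].
    exact: (measurableT_comp mU2 measurable_snd).
  have mfr := continuous_completed_measurable (mu := mu) (cf1 r).
  exact: (measurableT_comp mfr measurable_fst).
apply: (@measurable_fun_cvg _ _ _ _ (fun n => g (lU n).1 (lU n).2)).
  by move=> n; have [oU _ _] := HlU n; exact: mg.
move=> [s x] _; apply/cvgrPdist_lt => e e0.
near=> n.
have [_ cov err] := HlU n.
have ne : n.+1%:R^-1 < e by near: n; exact: near_infty_natSinv_lt (PosNum e0).
apply: lt_trans ne.
have [r0 r0l Ur0] := cov x.
suff : exists2 r, (lU n).2 r x & g (lU n).1 (lU n).2 (s, x) = f (s, r).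
  by move=> [r Ur ->]; exact: err.
elim: (lU n).1 r0l => [//|r l IH]; rewrite inE => r0l /=.
case: ifPn => [/set_mem Ur|rx]; first by exists r.
apply: IH; move: r0l => /predU1P[r0r|//].
by move: rx; rewrite -r0r mem_set.
Unshelve. all: by end_near. Qed.

(** The supremum may be uncountable, but it is lower semicontinuous: its strict superlevel sets are
    unions of open sets. *)
Lemma measurable_sup_continuous (R : realType) (T : ptopologicalType)
    (f : T * T -> R) :
  (forall r, continuous (fun s => f (s, r))) ->
  measurable_fun [set: borel T]
    (fun s : T => ereal_sup [set (f (s, r))%:E | r in [set: T]]).
Proof.
move=> cf; apply: (measurability _ (ErealGenOInfty.measurableE R)).
move=> _ [_ [a ->] <-]; rewrite setTI preimage_itvoy.
apply: sub_sigma_algebra.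
rewrite (_ : [set _ | _] =
    \bigcup_(r in [set: T]) ((fun s => f (s, r)) @^-1` [set y | a < y])).
  apply: bigcup_open => r _; apply: open_comp; last exact: open_gt.
  by move=> s _; exact: cf.
apply/seteqP; split=> s /=.
- by move=> /ereal_sup_gt [_ [r _ <-]]; rewrite lte_fin => ar; exists r.
- move=> [r _ /=]; rewrite -lte_fin => /lt_le_trans; apply.
  by apply: ereal_sup_ubound; exists r.
Qed.

Lemma measurable_along_map (R : realType) (T : ptopologicalType)
    (mu : borel_prob R T) (f : T * T -> R) (S : completed mu -> borel T) :
  compact [set: T] -> continuous f ->
  measurable_fun [set: completed mu] S ->
  measurable_fun [set: completed mu] (fun s : completed mu => f (s : T, S s)).
Proof.
move=> cT cf mS; have mf := continuous_joint_measurable (mu := mu) cT cf.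
have mid := @measurable_id _ (completed mu) setT.
exact: (measurableT_comp mf (measurable_fun_pair mid mS)).
Qed.

(** * Measurable almost maximizers *)

Lemma approximate_maximizer (R : realType) (T : ptopologicalType)
    (mu : borel_prob R T) (f : T * T -> R) (e : R) :
  compact [set: T] -> continuous f -> 0 < e ->
  exists2 S : completed mu -> borel T, measurable_fun [set: completed mu] S &
    forall s : T,
      (ereal_sup [set (f (s, r))%:E | r in [set: T]] <= (f (s, S s) + e)%:E)%E.
Proof.
move=> cT cf e0.
have cf1 r := continuous_section_l (t := r) cf.
have [l [U [_ cov err]]] := compact_uniform_net cT cf e0.
have [S mS Smax] : exists2 S : completed mu -> borel T,
    measurable_fun [set: completed mu] S &
    forall (s : T) r, r \in l -> f (s, r) <= f (s, S s).
  elim: l {cov} => [|p l [S mS Smax]].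
    by exists (cst point).
  exists (fun s => if f (s : T, S s) <= f (s : T, p) then p : borel T else S s).
    have mSp : measurable_fun [set: completed mu]
        (fun s : completed mu => f (s : T, S s) <= f (s : T, p)).
      apply: measurable_fun_ler; first exact: measurable_along_map.
      exact: (continuous_completed_measurable (cf1 p)).
    exact: (measurable_fun_ifT mSp (measurable_cst (p : borel T)) mS).
  move=> s r; rewrite inE => /predU1P[->|/(Smax s) rS]; case: ifPn => //.
  - by rewrite -ltNge => /ltW.
  - exact: le_trans.
(* Replacing an arbitrary [x] by its net point [r] loses less than [e], and [S s] is at least as
   good as [r]. *)
exists S => // s; apply: ge_ereal_sup => _ [x _ <-]; rewrite lee_fin.
have [r rl Ur] := cov x.
have := err s _ _ Ur; have := Smax s _ rl.
by rewrite ltr_norml => ? /andP[_ ?]; lra.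
Qed.

(** * The completed measure and two-point kernels *)

Lemma completionE (R : realType) (T : ptopologicalType)
    (mu : borel_prob R T) (A : set (borel T)) :
  measurable A -> completion mu (A : set (completed mu)) = mu A.
Proof. by move=> mA; exact: measurable_mu_extE. Qed.

Lemma completion_setT (R : realType) (T : ptopologicalType)
    (mu : borel_prob R T) : completion mu [set: completed mu] = 1%E.
Proof. by rewrite completionE//; exact: probability_setT. Qed.

(** [mu] is the image of its completion under the identity, so this is a change of variables. It
    brings the integral of [phi], taken against [mu], to the measure used for plans. *)
Lemma ge0_integral_completion (R : realType) (T : ptopologicalType)
    (mu : borel_prob R T) (f : T -> \bar R) :
  measurable_fun [set: borel T] f -> (forall x, 0 <= f x)%E ->
  (\int[mu]_(s in [set: borel T]) f s =
   \int[completion mu]_(s in [set: completed mu]) f s)%E.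
Proof.
move=> mf f0.
have mid := @measurable_completed_id _ _ mu.
rewrite -[RHS](@ge0_integral_pushforward _ _ _ _ _ _ mid
  (completion mu) setT)//.
by apply: eq_measure_integral => A mA _; rewrite /pushforward/= completionE.
Qed.

(** The kernel is the mixture of the Dirac masses at [S1 s] and [S2 s]. Such mixtures supply the
    convexity that maps alone do not have. *)
Lemma two_point_kernel (R : realType) (T : ptopologicalType)
    (mu : borel_prob R T) (S1 S2 : completed mu -> borel T) (t : R) :
  measurable_fun [set: completed mu] S1 ->
  measurable_fun [set: completed mu] S2 -> 0 <= t <= 1 ->
  exists2 pi : completed mu -> borel_prob R T,
    measurable_fun [set: completed mu] pi &
    forall s (g : T -> R), measurable_fun [set: borel T] g ->
      (forall x, 0 <= g x) ->
      (\int[pi s]_r (g r)%:E = (t * g (S1 s) + (1 - t) * g (S2 s))%:E)%E.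
Proof.
move=> mS1 mS2 /andP[t0 t1].
have t1' : 0 <= 1 - t by rewrite subr_ge0.
pose m (s : completed mu) : {measure set (borel T) -> \bar R} :=
  measure_add (mscale (NngNum t0) \d_(S1 s)) (mscale (NngNum t1') \d_(S2 s)).
have mE s A : m s A = (t%:E * \d_(S1 s) A + (1 - t)%:E * \d_(S2 s) A)%E.
  exact: (measure_addE (mscale (NngNum t0) \d_(S1 s))
                       (mscale (NngNum t1') \d_(S2 s)) A).
have mT s : m s setT = 1%E by rewrite mE !diracT !mule1 -EFinD addrC subrK.
have nE s P A : mnormalize (m s) P A = m s A.
  by rewrite /mnormalize mT onee_eq0 /= invr1 mule1.
(* [m s] has mass 1, so normalizing only repackages it as a probability. *)
exists (fun s => mnormalize (m s) point : pprobability (borel T) R).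
  (* It suffices to test the generators, the sets of measures giving [A] mass less than [r]; their
     preimages are sublevel sets of a combination of Dirac evaluations. *)
  apply: (measurability
    (@pset _ _ _ : set (set (pprobability (borel T) R)))) => //.
  move=> _ -[_ [r r01] [A mA <-]] <-.
  have mmA : measurable_fun [set: completed mu]
      (fun s => t%:E * \d_(S1 s) A + (1 - t)%:E * \d_(S2 s) A)%E.
    by apply: emeasurable_funD; apply: measurable_funeM;
      apply: (measurableT_comp (measurable_fun_dirac mA)).
  rewrite setTI /mset.
  have := emeasurable_fun_infty_o measurableT mmA r%:E; rewrite setTI.
  congr measurable; by apply/seteqP; split=> s /=; rewrite nE mE.
move=> s g mg g0.
have mgE : measurable_fun [set: borel T] (EFin \o g) by exact/measurable_EFinP.
rewrite (eq_measure_integral (m s)); last by move=> A _ _; exact: nE.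
rewrite ge0_integral_measure_add//; last by move=> x _; rewrite lee_fin.
rewrite !ge0_integral_mscale//; try by move=> x _; rewrite lee_fin.
by rewrite !integral_dirac//= !diracT !mul1e -!EFinM -EFinD.
Qed.

(** * Separation in the plane of costs and gains *)

(** Seen from [(eps, v)], a point of larger cost has slope at most that of any point of smaller
    cost, since otherwise a mixture of the two with cost [eps] would gain more than [v]. The point
    of cost below [eps] is a Slater condition: it keeps the slopes bounded. *)
Lemma lagrange_multiplier (R : realType) (P : set (R * R)) (v eps : R) :
  (forall p q t, P p -> P q -> 0 <= t <= 1 ->
    t * p.1 + (1 - t) * q.1 <= eps -> t * p.2 + (1 - t) * q.2 <= v) ->
  (exists2 p, P p & p.1 < eps) ->
  exists2 lam, 0 <= lam & forall p, P p -> p.2 <= v + lam * (p.1 - eps).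
Proof.
move=> mix [p0 Pp0 p0e].
have le_v p : P p -> p.1 <= eps -> p.2 <= v.
  move=> Pp pe; have := mix p p 1 Pp Pp; rewrite subrr !mul1r !mul0r !addr0.
  by apply=> //; rewrite ler01 lexx.
pose slopes := [set (p.2 - v) / (p.1 - eps) | p in P `&` [set p | eps < p.1]].
have slopes_ub q : P q -> q.1 < eps -> ubound slopes ((v - q.2) / (eps - q.1)).
  move=> Pq qe _ [p [Pp /= ep] <-].
  have d1 : 0 < p.1 - eps by rewrite subr_gt0.
  have d2 : 0 < eps - q.1 by rewrite subr_gt0.
  have d3 : 0 < p.1 - q.1 by lra.
  rewrite ler_pdivrMr// mulrAC ler_pdivlMr//.
  (* This weight gives the mixture cost exactly [eps]. *)
  have := mix p q ((eps - q.1) / (p.1 - q.1)) Pp Pq.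
  have -> : 1 - (eps - q.1) / (p.1 - q.1) = (p.1 - eps) / (p.1 - q.1).
    by field; rewrite gt_eqF.
  rewrite divr_ge0 ?(ltW d2) ?(ltW d3)//= ler_pdivrMr// mul1r.
  have -> : (eps - q.1) / (p.1 - q.1) * p.1 + (p.1 - eps) / (p.1 - q.1) * q.1
     = eps by field; rewrite gt_eqF.
  have -> : (eps - q.1) / (p.1 - q.1) * p.2 + (p.1 - eps) / (p.1 - q.1) * q.2
     = ((eps - q.1) * p.2 + (p.1 - eps) * q.2) / (p.1 - q.1).
    by field; rewrite gt_eqF.
  rewrite ler_pdivrMr// => /(_ _ (lexx _)) H.
  have {}H : (eps - q.1) * p.2 + (p.1 - eps) * q.2 <= v * (p.1 - q.1).
    by apply: H; lra.
  lra.
(* Adding 0 makes the set non-empty and its supremum non-negative; the upper bounds survive because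
   points of cost below [eps] gain at most [v]. *)
pose L := [set 0] `|` slopes.
have L_ub q : P q -> q.1 < eps -> ubound L ((v - q.2) / (eps - q.1)).
  move=> Pq qe x [->|]; last exact: slopes_ub.
  by rewrite divr_ge0// subr_ge0 ?le_v// ltW.
have supL : has_sup L by split; [exists 0; left|eexists; exact: L_ub Pp0 p0e].
exists (sup L); first by apply: ub_le_sup; [exact: supL.2|left].
(* Left of [eps] the supremum is the least upper bound, right of it an upper bound, and at [eps] the
   slope does not matter. *)
move=> p Pp; have [pe|ep|pe] := ltgtP p.1 eps.
- have : sup L <= (v - p.2) / (eps - p.1).
    by apply: ge_sup; [exact: supL.1|exact: L_ub].
  rewrite ler_pdivlMr ?subr_gt0//; lra.
- have : (p.2 - v) / (p.1 - eps) <= sup L.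
    by apply: ub_le_sup; [exact: supL.2|right; exists p].
  rewrite ler_pdivrMr ?subr_gt0//; lra.
- by rewrite pe subrr mulr0 addr0 le_v// pe.
Qed.

(** * Bounded integrands and weak duality *)

Lemma continuous_compact_bounded (R : realType) (T : topologicalType)
    (f : T -> R) :
  compact [set: T] -> continuous f -> exists M, forall x, `|f x| <= M.
Proof.
move=> cT cf; have : compact (f @` setT).
  by apply: continuous_compact => //; exact: continuous_subspaceT.
move=> /compact_bounded [M [_ HM]]; exists (M + 1) => x.
by apply: (HM (M + 1)); [rewrite ltrDl|exists x].
Qed.

Lemma integrable_along_map (R : realType) (T : ptopologicalType)
    (mu : borel_prob R T) (f : T * T -> R) (S : completed mu -> borel T) :
  compact [set: T] -> continuous f ->
  measurable_fun [set: completed mu] S ->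
  (completion mu).-integrable setT
    (EFin \o (fun s : completed mu => f (s : T, S s))).
Proof.
move=> cT cf mS.
apply: (@measurable_bounded_integrable _ (completed mu) R (completion mu)).
- exact: measurableT.
- by rewrite completion_setT ltry.
- exact: measurable_along_map.
have [|M HM] := continuous_compact_bounded _ cf.
  by rewrite -setXTT; exact: compact_setX.
by exists M; split; [exact: num_real|move=> x /ltW Mx s _; exact: le_trans Mx].
Qed.

Lemma ge0_integralZD d (W : measurableType d) (R : realType)
    (m : {measure set W -> \bar R}) (lam : R) (f h : W -> \bar R) :
  0 <= lam -> measurable_fun setT f -> measurable_fun setT h ->
  (forall x, 0 <= f x)%E -> (forall x, 0 <= h x)%E ->
  (\int[m]_x (lam%:E * f x + h x) = lam%:E * \int[m]_x f x + \int[m]_x h x)%E.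
Proof.
move=> lam0 mf mh f0 h0; rewrite ge0_integralD//.
- by rewrite ge0_integralZl.
- by move=> x _; rewrite mule_ge0.
- exact: measurable_funeM.
Qed.

(** The pointwise bound is integrated first against [pi s], then against the completed measure.
    Staying put costs nothing, so the supremum is at least [g s] and all the terms added are
    non-negative; the integrals then split even if infinite. *)
Lemma weak_duality (R : realType) (T : ptopologicalType)
    (mu : borel_prob R T) (g : T -> R) (c : T * T -> R) (lam eps : R)
    (pi : completed mu -> borel_prob R T) :
  compact [set: T] -> continuous g -> continuous c ->
  (forall r, 0 <= g r) -> (forall s r, 0 <= c (s, r)) ->
  (forall s, c (s, s) = 0) -> 0 <= lam ->
  measurable_fun [set: completed mu] pi ->
  (\int[completion mu]_s \int[pi s]_r (c (s, r))%:E <= eps%:E)%E ->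
  (\int[completion mu]_s \int[pi s]_r (g r)%:E <=
   (lam * eps)%:E + \int[mu]_s ereal_sup [set (g r - lam * c (s, r))%:E
                                         | r in [set: T]])%E.
Proof.
move=> cT cg cc g0 c0 cd lam0 mpi cost.
set ph := (fun s : borel T => ereal_sup _).
have ph_ub s r : ((g r - lam * c (s, r))%:E <= ph s)%E.
  by apply: ereal_sup_ubound; exists r.
have ph0 s : (0 <= ph s)%E.
  by apply: le_trans (ph_ub s s); rewrite cd mulr0 subr0 lee_fin.
have cc1 r := continuous_section_l (t := r) cc.
have cc2 s := continuous_section_r (s := s) cc.
have mph : measurable_fun [set: borel T] ph.
  apply: (measurable_sup_continuous (f := fun z => g z.2 - lam * c z)) => r s.
  apply: cvgB; first exact: cvg_cst.
  by apply: cvgMr; exact: cc1.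
(* A measurable [pi] is a probability kernel, and integrating a jointly measurable function along a
   kernel is measurable in [s]. *)
have mkern (h : T * T -> R) : continuous h -> (forall z, 0 <= h z) ->
    measurable_fun [set: completed mu]
      (fun s : completed mu => \int[pi s]_r (h (s : T, r))%:E)%E.
  move=> ch h0.
  apply: (measurable_fun_integral_finite_kernel
    (fun z : completed mu * borel T => (h z)%:E)
    (kprobability mpi)) => //.
  apply/measurable_EFinP; exact: continuous_joint_measurable.
have mg := continuous_borel_measurable cg.
rewrite (ge0_integral_completion mu mph ph0).
have ph_le s r : ((g r)%:E <= (lam * c (s, r))%:E + ph s)%E.
  by rewrite -leeBlDl// -EFinB; exact: ph_ub.
clearbody ph.
pose C (s : completed mu) := (\int[pi s]_r (c (s : T, r))%:E)%E.
have mC : measurable_fun [set: completed mu] C by apply: mkern => // -[].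
have C0 s : (0 <= C s)%E by apply: integral_ge0 => r _; rewrite lee_fin.
have mphc : measurable_fun [set: completed mu] (ph : completed mu -> \bar R).
  exact: (measurableT_comp mph (@measurable_completed_id _ _ mu)).
apply: (@le_trans _ _ (lam%:E * \int[completion mu]_s C s +
                       \int[completion mu]_s ph s)%E); last first.
  by rewrite leeD2r// EFinM lee_wpmul2l.
rewrite -(ge0_integralZD (completion mu) lam0 mC mphc C0 ph0).
apply: (@ge0_le_integral _ (completed mu) R (completion mu) setT measurableT).
- by move=> s _; apply: integral_ge0 => r _; rewrite lee_fin.
- apply: (mkern (fun z => g z.2)) => // z.
  by apply: continuous_comp; [exact: cvg_snd|exact: cg].
- apply: emeasurable_funD; last exact: mphc.
  exact: (measurable_funeM lam%:E mC).
move=> s _.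
have mcs : measurable_fun [set: borel T] (fun r : T => (c (s : T, r))%:E).
  by apply/measurable_EFinP; exact: continuous_borel_measurable (cc2 s).
have cs0 (r : borel T) : (0 <= (c (s : T, r))%:E)%E by rewrite lee_fin.
(* As [pi s] has mass 1, the constant [ph s] is its own integral, and the two sides can be compared
   under one integral. *)
have -> : ph s = (\int[pi s]_(r in [set: borel T]) cst (ph s) r)%E.
  by rewrite integral_cst// [X in (_ * X)%E]probability_setT mule1.
rewrite -(ge0_integralZD (pi s) lam0 mcs (measurable_cst _) cs0); last first.
  by move=> r; exact: ph0.
apply: (@ge0_le_integral _ (borel T) R (pi s) setT measurableT).
- by move=> r _; rewrite lee_fin.
- exact/measurable_EFinP.
- apply: emeasurable_funD; last exact: measurable_cst.
  exact: (measurable_funeM lam%:E mcs).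
by move=> r _; rewrite -EFinM; exact: ph_le.
Qed.

(** * Strong duality *)

(** The pairs where moving gains at least [e] form a compact set [D] off the diagonal, so [c] has a
    positive minimum there and a large multiplier cancels the gain. Off [D] any non-negative penalty
    will do. *)
Lemma penalty_dominates (R : realType) (T : ptopologicalType)
    (g : T -> R) (c : T * T -> R) (e : R) :
  compact [set: T] -> continuous g -> continuous c -> (forall r, 0 <= g r) ->
  (forall s r, 0 <= c (s, r)) -> (forall s r, c (s, r) = 0 -> s = r) -> 0 < e ->
  exists2 lam, 0 <= lam & forall s r, g r - lam * c (s, r) <= g s + e.
Proof.
move=> cT cg cc g0 c0 cd e0.
have cTT : compact [set: T * T] by rewrite -setXTT; exact: compact_setX.
have [M HM] := continuous_compact_bounded cT cg.
pose D : set (T * T) := [set z | g z.1 + e <= g z.2].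
have cg1 : continuous (fun z : T * T => g z.1).
  by move=> z; apply: continuous_comp; [exact: cvg_fst|exact: cg].
have cg2 : continuous (fun z : T * T => g z.2).
  by move=> z; apply: continuous_comp; [exact: cvg_snd|exact: cg].
have cD : compact D.
  apply: (subclosed_compact _ cTT) => //.
  rewrite (_ : D = (fun z => g z.2 - g z.1) @^-1` [set y | e <= y]).
    apply: closed_comp; last exact: closed_ge.
    by move=> z _; apply: cvgB; [exact: cg2|exact: cg1].
  by apply/seteqP; split=> z; rewrite /D /= lerBrDl.
have [[z0 Dz0]|D0] := pselect (D !=set0); last first.
  exists 0 => // s r; rewrite mul0r subr0 leNgt; apply/negP => /ltW gsr.
  by apply: D0; exists (s, r).
have [|z1 z1D z1min] := compact_EVT_min (ex_intro _ z0 Dz0) cD (f := c).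
  exact: continuous_subspaceT.
have c1 : 0 < c z1.
  case: z1 z1D {z1min} => s r /set_mem; rewrite /D /= => gsr.
  rewrite lt0r c0 andbT; apply/eqP => /cd sr.
  by move: gsr; rewrite sr; lra.
have M0 : 0 <= M by apply: le_trans (HM point); exact: normr_ge0.
have lam0 : 0 <= M / c z1 by rewrite divr_ge0// ltW.
(* On [D] the penalty is then at least [M], a bound for [g], so the penalized gain is at most 0. *)
exists (M / c z1) => // s r.
have [Dsr|] := leP (g s + e) (g r).
  have : M <= M / c z1 * c (s, r).
    rewrite mulrAC ler_pdivlMr// ler_wpM2l//.
    by apply: z1min; exact/mem_set.
  have := HM r; rewrite ler_norml => /andP[_]; have := g0 s; lra.
have : 0 <= M / c z1 * c (s, r) by rewrite mulr_ge0.
lra.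
Qed.

(** One plan serves every [f]: the cost function reads off its cost, and a function of the second
    variable alone its gain. Both are therefore mixed with the same weight. *)
Lemma two_point_plan (R : realType) (T : ptopologicalType)
    (mu : borel_prob R T) (S1 S2 : completed mu -> borel T) (t : R) :
  compact [set: T] -> measurable_fun [set: completed mu] S1 ->
  measurable_fun [set: completed mu] S2 -> 0 <= t <= 1 ->
  exists2 pi : completed mu -> borel_prob R T,
    measurable_fun [set: completed mu] pi &
    forall f : T * T -> R, continuous f -> (forall z, 0 <= f z) ->
      (\int[completion mu]_s \int[pi s]_r (f (s : T, r))%:E =
       (t * (\int[completion mu]_s f (s : T, S1 s))%R +
        (1 - t) * (\int[completion mu]_s f (s : T, S2 s))%R)%:E)%E.
Proof.
move=> cT mS1 mS2 t01.
have [pi mpi pif] := two_point_kernel mS1 mS2 t01.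
exists pi => // f cf f0.
have cf2 s := continuous_section_r (s := s) cf.
under eq_integral => s _.
  rewrite (pif s (fun r => f (s : T, r))
    (continuous_borel_measurable (cf2 s)))//.
  over.
have i1 := integrable_along_map cT cf mS1.
have i2 := integrable_along_map cT cf mS2.
have e1 := RintegralZl t measurableT i1.
have e2 := RintegralZl (1 - t) measurableT i2.
have i1t := integrableZl measurableT t i1.
have i2t := integrableZl measurableT (1 - t) i2.
rewrite -e1 -e2 -(RintegralD measurableT i1t i2t) /Rintegral fineK//.
exact: integrable_fin_num (integrableD measurableT i1t i2t).
Qed.

Lemma Rintegral_penalized d (W : measurableType d) (R : realType)
    (m : {measure set W -> \bar R}) (f h : W -> R) (lam e : R) :
  m setT = 1%E ->
  m.-integrable setT (EFin \o f) -> m.-integrable setT (EFin \o h) ->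
  m.-integrable setT (EFin \o (fun x => f x - lam * h x + e)) /\
  \int[m]_x (f x - lam * h x + e) = \int[m]_x f x - lam * \int[m]_x h x + e.
Proof.
move=> mT if_ ih.
have iZ : m.-integrable setT (EFin \o (fun x => lam * h x)).
  exact: (integrableZl measurableT lam ih).
have iB : m.-integrable setT (EFin \o (fun x => f x - lam * h x)).
  exact: (integrableB measurableT if_ iZ).
have ie : m.-integrable setT (EFin \o cst e).
  apply: measurable_bounded_integrable => //; first by rewrite mT ltry.
  exact: bounded_cst.
split; first exact: (integrableD measurableT iB ie).
rewrite (RintegralD measurableT iB ie) (RintegralB measurableT if_ iZ).
by rewrite (RintegralZl lam measurableT ih) Rintegral_cst// mT mulr1.
Qed.

(** It suffices to find [lam] and one map [S] that almost maximizes the penalized gain and whose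
    point lies on or below the line of slope [lam] through [(eps, v)]. On integrating, the terms
    [lam * E S c] cancel and [v + e] remains. *)
Lemma strong_duality (R : realType) (T : ptopologicalType)
    (mu : borel_prob R T) (g : T -> R) (c : T * T -> R) (eps v e : R) :
  compact [set: T] -> continuous g -> continuous c ->
  (forall r, 0 <= g r) -> (forall s r, 0 <= c (s, r)) ->
  (forall s r, c (s, r) = 0 <-> s = r) -> 0 <= eps ->
  (forall pi : completed mu -> borel_prob R T,
    measurable_fun [set: completed mu] pi ->
    (\int[completion mu]_s \int[pi s]_r (c (s, r))%:E <= eps%:E)%E ->
    (\int[completion mu]_s \int[pi s]_r (g r)%:E <= v%:E)%E) ->
  0 < e ->
  exists2 lam, 0 <= lam &
    ((lam * eps)%:E + \int[mu]_s ereal_sup [set (g r - lam * c (s, r))%:E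
                                           | r in [set: T]] <= (v + e)%:E)%E.
Proof.
move=> cT cg cc g0 c0 cd eps0 hv e0.
have cs s : c (s, s) = 0 by apply/cd.
have cg2 : continuous (fun z : T * T => g z.2).
  by move=> z; apply: continuous_comp; [exact: cvg_snd|exact: cg].
have cf lam : continuous (fun z => g z.2 - lam * c z).
  move=> z; apply: cvgB; first exact: cg2.
  by apply: cvgMr; exact: cc.
have cc1 r := continuous_section_l (t := r) cc.
pose E (S : completed mu -> borel T) (f : T * T -> R) :=
  (\int[completion mu]_s f (s : T, S s))%R.
have mix S1 S2 t : measurable_fun setT S1 -> measurable_fun setT S2 ->
    0 <= t <= 1 -> t * E S1 c + (1 - t) * E S2 c <= eps ->
    t * E S1 (fun z => g z.2) + (1 - t) * E S2 (fun z => g z.2) <= v.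
  move=> mS1 mS2 t01 cost.
  have [pi mpi piE] := two_point_plan cT mS1 mS2 t01.
  rewrite -lee_fin -(piE (fun z => g z.2))//; apply: hv => //.
  by rewrite piE ?lee_fin// => -[].
have mid := @measurable_completed_id _ _ mu.
have Eid : E id c = 0.
  rewrite /E; under eq_Rintegral do rewrite cs.
  by rewrite Rintegral_cst// mul0r.
suff [lam lam0 [S mS [Smax SE]]] : exists2 lam, 0 <= lam &
    exists2 S : completed mu -> borel T, measurable_fun setT S &
    (forall s : T, (ereal_sup [set (g r - lam * c (s, r))%:E | r in [set: T]] <=
      (g (S s) - lam * c (s, S s) + e)%:E)%E) /\
    E S (fun z => g z.2) <= v + lam * (E S c - eps).
  exists lam => //; set ph := (fun s : borel T => ereal_sup _).
  have mph : measurable_fun [set: borel T] ph.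
    apply: (measurable_sup_continuous (f := fun z => g z.2 - lam * c z)) => r s.
    apply: cvgB; first exact: cvg_cst.
    by apply: cvgMr; exact: cc1.
  have ph0 s : (0 <= ph s)%E.
    apply: (@le_trans _ _ (g s)%:E); first by rewrite lee_fin.
    by apply: ereal_sup_ubound; exists s => //; rewrite cs mulr0 subr0.
  rewrite (ge0_integral_completion mu mph ph0).
  have mphc : measurable_fun [set: completed mu] (ph : completed mu -> \bar R).
    exact: (measurableT_comp mph mid).
  have i1 := integrable_along_map cT cg2 mS.
  have i2 := integrable_along_map cT cc mS.
  have ph_le (s : T) : (ph s <= (g (S s) - lam * c (s, S s) + e)%:E)%E.
    exact: Smax.
  clearbody ph.
  have [iS ES] := Rintegral_penalized lam e (completion_setT mu) i1 i2.
  apply: (@le_trans _ _ ((lam * eps)%:E + \int[completion mu]_s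
      (g (S s) - lam * c (s : T, S s) + e)%:E)%E).
    rewrite leeD2l//.
    apply: (@ge0_le_integral _ (completed mu) R (completion mu)
      setT measurableT).
    - by move=> s _; exact: ph0.
    - exact: mphc.
    - exact: (measurable_int _ iS).
    - by move=> s _; exact: ph_le.
  have -> : (\int[completion mu]_s (g (S s) - lam * c (s : T, S s) + e)%:E =
      (E S (fun z => g z.2) - lam * E S c + e)%:E)%E.
    rewrite -[LHS](fineK (integrable_fin_num measurableT iS)).
    by congr (_%:E); exact: ES.
  by rewrite -EFinD lee_fin; clear -SE; lra.
(* For [eps = 0] the identity serves as [S]: its cost equals [eps], so the slope term vanishes, and
   its gain is at most [v] by mixing it with itself. *)
have [eps_eq0|eps_neq0] := eqVneq eps 0.
  have [lam lam0 pen] :=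
    penalty_dominates cT cg cc g0 c0 (fun s r => proj1 (cd s r)) e0.
  exists lam => //; exists id => //; split.
    move=> s; apply: ge_ereal_sup => _ [r _ <-].
    by rewrite lee_fin cs mulr0 subr0.
  have := mix id id 1 mid mid; rewrite ler01 lexx subrr !mul1r !mul0r !addr0.
  by rewrite Eid eps_eq0 subrr mulr0 addr0; exact.
pose P := [set (E S c, E S (fun z => g z.2)) | S in
  [set S : completed mu -> borel T | measurable_fun setT S]].
have [||lam lam0 lamP] := @lagrange_multiplier R P v eps.
- by move=> _ _ t [S1 mS1 <-] [S2 mS2 <-] t01 /=; exact: mix.
(* The identity has cost 0, below [eps], and is the Slater point. *)
- exists (E id c, E id (fun z => g z.2)); first by exists id.
  by rewrite /= Eid lt0r eps_neq0.
exists lam => //.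
(* The multiplier is valid for all measurable maps at once, so [S] may be chosen after it. *)
have [S mS Smax] := approximate_maximizer mu cT (cf lam) e0.
exists S => //; split; first exact: Smax.
by apply: (lamP (E S c, E S (fun z => g z.2))); exists S.
Qed.

(** * The duality formula *)

Theorem theorem3p2 (R : realType) (X Y : ptopologicalType)
    (d : measure_display) (Par : measurableType d)
    (mu : borel_prob R (X * Y)%type) (eps : R) (G : Par)
    (c : (X * Y) * (X * Y) -> R) (ell : (X * Y) * Par -> R)
    (K : X * Y -> set (borel_prob R (X * Y)%type))
    (hX : polish R X) (hY : polish R Y)
    (hS : polish R (X * Y)%type) (hSc : compact [set: X * Y])
    (heps : 0 <= eps)
    (hc0 : forall s r : X * Y, 0 <= c (s, r))
    (hcc : continuous c)
    (hcd : forall s r : X * Y, c (s, r) = 0 <-> s = r)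
    (hell0 : forall (r : X * Y) (G' : Par), 0 <= ell (r, G'))
    (hellm : measurable_fun [set: borel (X * Y)%type * Par] ell)
    (hellc : continuous (fun r : X * Y => ell (r, G)))
    (hK : forall s : X * Y, K s = [set: borel_prob R (X * Y)%type])
    (hKae : {ae mu, forall s, [/\ K s !=set0, weak_star_closed (K s) &
                                  prob_convex (K s)]})
    (hOmega : Omega mu K c eps !=set0) :
  robust_value ell G (Omega mu K c eps) =
  ereal_inf [set ((lam * eps)%:E + \int[mu]_s phi c ell lam G s)%E
            | lam in [set lam : R | 0 <= lam]].
Proof.
have cd0 s : c (s, s) = 0 by apply/hcd.
have cell0 r : 0 <= ell (r, G) by exact: hell0.
have inOmega (pi : completed mu -> borel_prob R (X * Y)%type) :
    measurable_fun [set: completed mu] pi ->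
    (\int[completion mu]_s \int[pi s]_r (c (s, r))%:E <= eps%:E)%E ->
    Omega mu K c eps pi.
  by move=> mpi cost; split => //; apply: aeW => s; rewrite hK.
apply/le_anti/andP; split.
  apply: ge_ereal_sup => _ [pi [mpi _ cost] <-].
  apply: le_ereal_inf_tmp => _ [lam /= lam0 <-].
  exact: (weak_duality hSc hellc hcc cell0 hc0 cd0 lam0 mpi cost).
have value_ge (pi : completed mu -> borel_prob R (X * Y)%type) :
    measurable_fun [set: completed mu] pi ->
    (\int[completion mu]_s \int[pi s]_r (c (s, r))%:E <= eps%:E)%E ->
    (\int[completion mu]_s \int[pi s]_r (ell (r, G))%:E <=
     robust_value ell G (Omega mu K c eps))%E.
  by move=> mpi cost; apply: ereal_sup_ubound; exists pi => //; exact: inOmega.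
have value0 : (0 <= robust_value ell G (Omega mu K c eps))%E.
  have [pi [mpi _ cost]] := hOmega.
  apply: le_trans (value_ge pi mpi cost).
  by apply: integral_ge0 => s _; apply: integral_ge0 => r _; rewrite lee_fin.
(* Non-negativity, from a plan in the non-empty [Omega], excludes the value minus infinity; for plus
   infinity the inequality is trivial, and a finite value is the [v] of [strong_duality]. *)
case: (robust_value _ _ _) value0 value_ge => [v||] // _ value_ge.
  apply/lee_addgt0Pr => e e0.
  have [lam lam0 le_lam] :=
    strong_duality hSc hellc hcc cell0 hc0 hcd heps value_ge e0.
  by apply: le_trans le_lam; apply: ereal_inf_lbound; exists lam.
exact: leey.
Qed.
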